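(* Assume that $0\le\operatorname{trace}(\mathcal A(x)\,\xi\otimes\xi)\le\Lambda$ for all $x\in\Omega$, $\xi\in\mathbb R^N$, $|\xi|=1$ (with $\Lambda>0$), that the Keller–Osserman condition $\int^{+\infty}\frac{ds}{\sqrt{G(s)}}<+\infty$ holds, and that there is $\omega:[0,\infty)\to[0,\infty)$ with $\omega(0^+)=0$ such that $$\operatorname{trace}(\mathcal A(x)X)-\operatorname{trace}(\mathcal A(y)Y)\le\omega\big(\alpha|x-y|^2\big)$$ whenever $x,y\in\Omega$, $\alpha>0$ and $X,Y\in\mathcal S^N$ satisfy $$-3\alpha\begin{pmatrix} I&0\\0&I\end{pmatrix}\le\begin{pmatrix}X&0\\0&-Y\end{pmatrix}\le3\alpha\begin{pmatrix}I&-I\\-I&I\end{pmatrix}.$$ For $\varepsilon>0$ and $n\in\mathbb N$ let $u_{\varepsilon,n}$ be the classical solution of $$-\varepsilon\Delta u_{\varepsilon,n}-\operatorname{trace}\mathcal A(\cdot)D^2u_{\varepsilon,n}+\beta(u_{\varepsilon,n})=\min\{f,n\}\ \text{ in }\Omega,\qquad u_{\varepsilon,n}=n\ \text{ on }\partial\Omega .$$ Then there exist two positive constants $A$ and $B$, independent of $n$, for which $$u_{\varepsilon,n}(x)\le\sum_{i=1}^N\Psi_\varepsilon\big(R^2-|x_i-x_{0,i}|^2\big)+\beta^{-1}\big(\|f\|_{Q_R(x_0)}\big),\quad x\in Q_R(x_0),$$ holds in any cube $Q_R(x_0)=\{x\in\mathbb R^N:|x_i-x_{0,i}|<R,\ i=1,\dots,N\}\subset\subset\Omega$,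 where $$\Psi_\varepsilon(\zeta)=\frac1A\,\Phi^{-1}\Big(\frac{B}{\sqrt{\Lambda+\varepsilon}}\,\zeta\Big),\quad 0<\zeta\le R^2,\qquad\text{with } \frac{B R^2}{\sqrt{\Lambda+\varepsilon}}<\Phi(0^+)\le+\infty .$$
   Context: $\Omega\subset\mathbb R^N$, $N>1$, is a bounded open set. $\mathcal S^N$ is the set of real symmetric $N\times N$ matrices with its usual ordering and $\mathcal S^N_+$ those with nonnegative eigenvalues. $\mathcal A:\Omega\to\mathcal S^N_+\setminus\{0\}$ is Lipschitz continuous; $\operatorname{trace}(\mathcal A\,\xi\otimes\xi)=\langle\mathcal A\xi,\xi\rangle$. $\beta:[0,\infty)\to[0,\infty)$ is continuous and increasing with $\beta(0)=0$; $f$ is a nonnegative uniformly continuous function on $\Omega$. $G(s)=\int_0^s\beta(r)\,dr$ and $\Phi(t)=\int_t^{+\infty}\frac{ds}{\sqrt{2G(s)}}$, $t>0$, a decreasing function with inverse $\Phi^{-1}$ and $\Phi(0^+)=\lim_{t\searrow0}\Phi(t)$. $\|f\|_{Q_R(x_0)}$ is the supremum norm of $f$ on $Q_R(x_0)$. The function $u_{\varepsilon,n}\in C^2(\Omega)$ (attaining the boundary value $n$) is taken to exist, as in the classical theory. *)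

(* Defs.v *)
From mathcomp Require Import all_boot all_order all_algebra.
From mathcomp Require Import all_classical all_reals all_analysis.

Set Implicit Arguments.
Unset Strict Implicit.
Unset Printing Implicit Defensive.

Import Order.TTheory GRing.Theory Num.Theory.
Import numFieldNormedType.Exports.

Local Open Scope classical_set_scope.
Local Open Scope ring_scope.

(* Points of R^N are row vectors. The library norm on 'rV[R]_N is the sup norm;
   it gives the usual topology, and so the usual open, bounded and compact sets
   and Lipschitz maps. Wherever the value of |x| matters, enorm is used. *)
Definition enorm {R : realType} {N : nat} (x : 'rV[R]_N) : R :=
  Num.sqrt (\sum_i x 0 i ^+ 2).

Definition tensor {R : realType} {N : nat} (xi : 'rV[R]_N) : 'M[R]_N :=
  xi^T *m xi.

Definition symmetric_mx {R : realType} {N : nat} (X : 'M[R]_N) : Prop :=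
  X^T = X.

Definition psd_mx {R : realType} {N : nat} (X : 'M[R]_N) : Prop :=
  symmetric_mx X /\ (forall a : R, eigenvalue X a -> 0 <= a).

Definition mx_le {R : realType} {N : nat} (X Y : 'M[R]_N) : Prop :=
  forall xi : 'rV[R]_N,
    (xi *m X *m xi^T) 0 0 <= (xi *m Y *m xi^T) 0 0.

Definition uniformly_continuous_on {R : realType} {N : nat}
    (Omega : set 'rV[R]_N) (f : 'rV[R]_N -> R) : Prop :=
  forall e : R, 0 < e -> exists2 d : R, 0 < d &
    forall x y, Omega x -> Omega y -> enorm (x - y) < d -> `|f x - f y| < e.

Definition frontier {T : topologicalType} (U : set T) : set T :=
  closure U `\` U°.

Definition compactly_contained {T : topologicalType} (U V : set T) : Prop :=
  compact (closure U) /\ closure U `<=` V.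

Definition cube {R : realType} {N : nat} (x0 : 'rV[R]_N) (r : R) :
    set 'rV[R]_N :=
  [set x | forall i, `|x 0 i - x0 0 i| < r].

Definition sup_norm {R : realType} {T : Type} (U : set T) (f : T -> R) : R :=
  sup [set `|f x| | x in U].

Definition partial {R : realType} {N : nat} (i : 'I_N)
    (u : 'rV[R]_N -> R) (x : 'rV[R]_N) : R :=
  'D_(delta_mx 0 i : 'rV[R]_N) u x.

Definition hessian {R : realType} {N : nat}
    (u : 'rV[R]_N -> R) (x : 'rV[R]_N) : 'M[R]_N :=
  \matrix_(i, j) partial j (partial i u) x.

Definition laplacian {R : realType} {N : nat}
    (u : 'rV[R]_N -> R) (x : 'rV[R]_N) : R :=
  \sum_i partial i (partial i u) x.

(* Omega is meant to be open: continuity at the points of Omega is then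
   continuity of the restriction. *)
Definition C1_on {R : realType} {N : nat}
    (Omega : set 'rV[R]_N) (u : 'rV[R]_N -> R) : Prop :=
  forall x, Omega x ->
    {for x, continuous u} /\
    forall i : 'I_N, derivable u x (delta_mx 0 i) /\
                     {for x, continuous (partial i u)}.

Definition C2_on {R : realType} {N : nat}
    (Omega : set 'rV[R]_N) (u : 'rV[R]_N -> R) : Prop :=
  C1_on Omega u /\ forall i : 'I_N, C1_on Omega (partial i u).

(* beta is only given on [0, +oo[, so the equation makes sense only for a
   nonnegative u; values of beta at negative arguments are never meant. *)
Definition classical_solution {R : realType} {N : nat}
    (Omega : set 'rV[R]_N) (calA : 'rV[R]_N -> 'M[R]_N) (beta : R -> R)
    (f : 'rV[R]_N -> R) (eps : R) (n : nat) (u : 'rV[R]_N -> R) : Prop :=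
  [/\ C2_on Omega u,
      (forall x, Omega x -> 0 <= u x),
      (forall x, Omega x ->
        - eps * laplacian u x - \tr (calA x *m hessian u x) + beta (u x)
        = Num.min (f x) n%:R) &
      (forall y, frontier Omega y ->
        u x @[x --> within Omega (nbhs y)] --> (n%:R : R))].

Definition primitive {R : realType} (beta : R -> R) (s : R) : R :=
  \int[lebesgue_measure]_(r in `[0, s]) beta r.

Definition Keller_Osserman {R : realType} (beta : R -> R) : Prop :=
  exists2 a : R, 0 < a &
    (\int[lebesgue_measure]_(s in `[a, +oo[)
       ((Num.sqrt (primitive beta s))^-1)%:E < +oo)%E.

Definition Phi {R : realType} (beta : R -> R) (t : R) : R :=
  \int[lebesgue_measure]_(s in `[t, +oo[)
    (Num.sqrt (2 * primitive beta s))^-1.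

(* +oo is a possible value. *)
Definition Phi0 {R : realType} (beta : R -> R) : \bar R :=
  lim ((Phi beta t)%:E @[t --> 0^'+]).

Definition Phi_inv {R : realType} (beta : R -> R) : R -> R :=
  'pinv_(fun=> 0) `]0, +oo[ (Phi beta).

Definition beta_inv {R : realType} (beta : R -> R) : R -> R :=
  'pinv_(fun=> 0) `[0, +oo[ beta.

Definition Psi {R : realType} (beta : R -> R) (Lambda eps A B zeta : R) : R :=
  A^-1 * Phi_inv beta (B / Num.sqrt (Lambda + eps) * zeta).

(* Main.v *)
Require Import Defs.
From mathcomp Require Import all_boot all_order all_algebra.
From mathcomp Require Import all_classical all_reals all_analysis.
From mathcomp Require Import measurable_realfun ring lra.

Import Order.TTheory GRing.Theory Num.Theory.
Import numFieldNormedType.Exports.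

Local Open Scope classical_set_scope.
Local Open Scope ring_scope.

(** Why the theorem holds.  Put L = Lambda + eps and phi = Phi_inv beta.  Since
    Phi' = - 1 / sqrt (2 G), the inverse phi is decreasing and convex, with
    phi' = - sqrt (2 G (phi)) and phi'' = beta phi, and it blows up at 0+.  The
    barrier on a cube of centre x0 and half-side r is
      w x = \sum_i K * phi (c * (r ^ 2 - (x_i - x0_i) ^ 2)),
    with K = 1 / A and c = B / sqrt L.  It is separable, so its Hessian is
    diagonal, and it blows up on the boundary of the cube.

    Suppose u exceeds w somewhere in the cube.  As u is bounded there, u - w has
    an interior maximum z at which u z > w z, and D2u <= D2w as quadratic forms
    at z ([exists_touching_point]).  The matrix P = calA z + eps I is positive
    semidefinite with diagonal entries at most L, so tr (P D2u) is at most
    \sum_i P_ii d_i, where d_i are the diagonal entries of D2w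
    ([tr_mul_psd_le_diag]).  The equation then gives
      beta (u z) <= f z + \sum_i P_ii d_i,
    and a contradiction follows once both terms are at most beta (w z) / 2,
    because beta is increasing.

    That is how the constants are chosen.  Uniformity in the cube comes
    from the boundedness of Omega: half-sides r are at most some D, and f is at
    most some F.
    - If c * D ^ 2 <= Phi 1, all values of phi that occur are at least 1.
    - The Keller-Osserman condition forces s <= C * beta s for s >= 1
      ([linear_le_beta]): indeed s / sqrt (G (2 s)) is at most a multiple of the
      integral of 1 / sqrt G over [s, 2 s].  Hence beta is unbounded, and
      sqrt (2 G) <= C * beta on [1, +oo[ for another C ([speed_le_beta]).
    - Take K >= 1 with 2 F <= beta K.  Then w z >= K gives
      f z <= beta (w z) / 2.
    - The entry d_i is a combination of sqrt (2 G (phi_i)) and beta (phi_i) with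
      coefficients of order c, and phi_i <= w, so a small c makes
      \sum_i P_ii d_i at most beta (w z) / 2 ([barrier_supersolution]).
    This proves u <= w; the term beta_inv of the supremum of f is nonnegative.
*)

(** * Traces of products of quadratic forms *)

Lemma form_addr_scale {R : comPzRingType} {n : nat} (P : 'M[R]_n)
    (v e : 'rV_n) (t : R) : P^T = P ->
  ((v + t *: e) *m P *m (v + t *: e)^T) 0 0
  = (v *m P *m v^T) 0 0 + 2 * t * (v *m P *m e^T) 0 0
    + t ^+ 2 * (e *m P *m e^T) 0 0.
Proof.
move=> symP.
have symq : (e *m P *m v^T) 0 0 = (v *m P *m e^T) 0 0.
  have -> : e *m P *m v^T = (v *m P *m e^T)^T.
    by rewrite !trmx_mul trmxK symP mulmxA.
  by rewrite mxE.
have addE (A B : 'M[R]_1) : (A + B) 0 0 = A 0 0 + B 0 0 by rewrite mxE.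
have scaleE a (A : 'M[R]_1) : (a *: A) 0 0 = a * A 0 0 by rewrite mxE.
rewrite linearD linearZ /= !mulmxDr !mulmxDl -!scalemxAl -!scalemxAr.
by rewrite !addE !scaleE symq; ring.
Qed.

Lemma form_delta {R : comPzRingType} {n : nat} (P : 'M[R]_n) (k l : 'I_n) :
  ((delta_mx 0 k : 'rV_n) *m P *m (delta_mx 0 l : 'rV_n)^T) 0 0 = P k l.
Proof. by rewrite -rowE trmx_delta -colE !mxE. Qed.

(** The 2 x 2 principal minors of a semidefinite matrix are nonnegative, so a
    vanishing diagonal forces every off-diagonal entry to vanish. *)
Lemma psd_diag_eq0 {R : realFieldType} {n : nat} (P : 'M[R]_n) :
  P^T = P -> (forall v : 'rV_n, 0 <= (v *m P *m v^T) 0 0) ->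
  (forall i, P i i = 0) -> P = 0.
Proof.
move=> symP psdP diag0; apply/matrixP => i j; rewrite !mxE.
have q := form_delta P.
have := psdP (delta_mx 0 i + 1 *: delta_mx 0 j).
have := psdP (delta_mx 0 i + (- 1) *: delta_mx 0 j).
rewrite !form_addr_scale// !q !diag0; lra.
Qed.

(** Symmetric Gaussian elimination: a pivot P_ii > 0 splits off the rank-one
    part w^T w / P_ii, w being the i-th row of P.  This part contributes
    (w H w^T) / P_ii <= 0 to the trace, the remainder is still semidefinite, and
    it has fewer nonzero diagonal entries. *)
Lemma tr_mul_psd_nsd {R : realFieldType} {n : nat} (P H : 'M[R]_n) :
  P^T = P -> (forall v : 'rV_n, 0 <= (v *m P *m v^T) 0 0) ->
  (forall v : 'rV_n, (v *m H *m v^T) 0 0 <= 0) ->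
  \tr (P *m H) <= 0.
Proof.
move=> + + nsdH.
have [m] := ubnP #|[set i | P i i != 0]|%SET.
elim: m P => // m IH P + symP psdP.
have [[i Pi]|diag0 _] := pselect (exists i, P i i != 0); last first.
  rewrite (psd_diag_eq0 _ symP psdP) ?mul0mx ?mxtrace0// => i.
  by apply/eqP/negPn/negP => Pi; apply: diag0; exists i.
move=> card_lt; set a := P i i in Pi.
have q := form_delta P.
have diag_ge0 k : 0 <= P k k by rewrite -q.
have a_gt0 : 0 < a by rewrite lt_def Pi diag_ge0.
set w := row i P; pose P' := P - a^-1 *: (w^T *m w).
have P'E k l : P' k l = P k l - a^-1 * (P i k * P i l).
  by rewrite !mxE big_ord1 !mxE.
have symP' : P'^T = P'.
  by rewrite linearB linearZ /= trmx_mul trmxK symP.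
have psdP' (v : 'rV_n) : 0 <= (v *m P' *m v^T) 0 0.
  have wE : (v *m P *m (delta_mx 0 i)^T) = v *m w^T.
    by rewrite -mulmxA -[P in LHS]symP -trmx_mul -rowE.
  have -> : (v *m P' *m v^T) 0 0
      = (v *m P *m v^T) 0 0 - a^-1 * ((v *m w^T) 0 0) ^+ 2.
    rewrite mulmxBr mulmxBl -scalemxAr -scalemxAl.
    have -> : v *m (w^T *m w) *m v^T = (v *m w^T) *m (v *m w^T)^T.
      by rewrite trmx_mul trmxK !mulmxA.
    rewrite mxE [X in _ + X]mxE [X in _ - X]mxE; congr (_ - _ * _).
    by rewrite mxE big_ord1 [X in _ * X]mxE -expr2.
  have := psdP (v + (- (a^-1 * (v *m w^T) 0 0)) *: delta_mx 0 i).
  rewrite form_addr_scale// q wE -/a => /le_trans; apply.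
  rewrite le_eqVlt; apply/orP; left; apply/eqP; field; exact: Pi.
have -> : \tr (P *m H) = \tr (P' *m H) + a^-1 * (w *m H *m w^T) 0 0.
  have {1}-> : P = P' + a^-1 *: (w^T *m w) by rewrite subrK.
  rewrite mulmxDl linearD /= -scalemxAl linearZ /= -mulmxA.
  by rewrite [\tr (w^T *m _)]mxtrace_mulC trace_mx11.
rewrite -[leRHS]addr0 lerD ?mulr_ge0_le0 ?invr_ge0 ?(ltW a_gt0)//.
apply: IH => //; rewrite ltnS in card_lt; apply: leq_trans card_lt.
apply: proper_card; apply/properP; split.
  apply/fintype.subsetP => k; rewrite !inE; apply: contra => /eqP Pk.
  have diag'_ge0 : 0 <= P' k k.
    by rewrite -(form_delta P').
  rewrite eq_le diag'_ge0 andbT P'E Pk sub0r oppr_le0 -expr2.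
  by rewrite mulr_ge0 ?sqr_ge0// invr_ge0 ltW.
by exists i; rewrite inE// P'E negbK -/a mulrA mulVf// mul1r subrr.
Qed.

Lemma tr_mul_psd_le_diag {R : realFieldType} {n : nat} (P H : 'M[R]_n)
    (d : 'I_n -> R) :
  P^T = P -> (forall v : 'rV_n, 0 <= (v *m P *m v^T) 0 0) ->
  (forall v : 'rV_n, (v *m H *m v^T) 0 0 <= \sum_i d i * v 0 i ^+ 2) ->
  \tr (P *m H) <= \sum_i P i i * d i.
Proof.
move=> symP psdP leH; pose D := diag_mx (\row_i d i).
have trPD : \tr (P *m D) = \sum_i P i i * d i.
  by apply: eq_bigr => i _; rewrite mul_mx_diag !mxE.
rewrite -trPD -subr_le0 -linearB /= -mulmxBr tr_mul_psd_nsd// => v.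
rewrite mulmxBr mulmxBl mxE [X in _ + X]mxE subr_le0 (le_trans (leH v))//.
rewrite mul_mx_diag !mxE; apply/ler_sum => i _.
by rewrite !mxE mulrAC -expr2 mulrC.
Qed.

Lemma tr_mul_tensor {R : realType} {N : nat} (A : 'M[R]_N) (xi : 'rV[R]_N) :
  \tr (A *m tensor xi) = (xi *m A *m xi^T) 0 0.
Proof. by rewrite /tensor mulmxA mxtrace_mulC mulmxA trace_mx11. Qed.

Lemma enormZ {R : realType} {N : nat} (a : R) (v : 'rV[R]_N) :
  enorm (a *: v) = `|a| * enorm v.
Proof.
rewrite /enorm -sqrtr_sqr -sqrtrM ?sqr_ge0// mulr_sumr; congr Num.sqrt.
by apply: eq_bigr => i _; rewrite mxE exprMn.
Qed.

Lemma form_ge0_of_unit {R : realType} {N : nat} (A : 'M[R]_N) :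
  (forall xi, enorm xi = 1 -> 0 <= (xi *m A *m xi^T) 0 0) ->
  forall v : 'rV_N, 0 <= (v *m A *m v^T) 0 0.
Proof.
move=> unitA v; have [v0|vN0] := eqVneq (enorm v) 0.
  have -> : v = 0.
    apply/rowP => i; rewrite mxE; apply/eqP; rewrite -sqrf_eq0.
    rewrite eq_le sqr_ge0 andbT.
    have /eqP : enorm v = 0 by [].
    rewrite sqrtr_eq0; apply: le_trans; rewrite (bigD1 i)//= lerDl.
    by apply: sumr_ge0 => j _; rewrite sqr_ge0.
  by rewrite !mul0mx mxE.
have e0 : 0 < enorm v by rewrite lt_def vN0 sqrtr_ge0.
have := unitA ((enorm v)^-1 *: v).
rewrite -!scalemxAl linearZ /= -scalemxAr scalerA mxE pmulr_rge0; last first.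
  by rewrite mulr_gt0// invr_gt0.
by apply; rewrite enormZ ger0_norm ?invr_ge0 ?(ltW e0)// mulVf.
Qed.

Lemma enorm_delta {R : realType} {N : nat} (i : 'I_N) :
  enorm (delta_mx 0 i : 'rV[R]_N) = 1.
Proof.
rewrite /enorm (bigD1 i)//= big1 => [|j ji]; rewrite !mxE ?eqxx.
  by rewrite expr1n addr0 sqrtr1.
by rewrite (negbTE ji) andbF expr0n.
Qed.

(** * Derivatives along lines of functions with continuous partials *)

Lemma is_derive_along_line {R : realType} {V : normedModType R} (u : V -> R)
    (x v : V) (t l : R) :
  is_derive (x + t *: v) v u l -> is_derive t 1 (fun s => u (x + s *: v)) l.
Proof.
move=> [du <-].
have E : (fun h : R => h^-1 *: (((fun s => u (x + s *: v)) \o shift t) (h *: 1)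
    - u (x + t *: v)))
  = (fun h => h^-1 *: ((u \o shift (x + t *: v)) (h *: v) - u (x + t *: v))).
  apply/funext => h /=; congr (_ *: (u _ - _)).
  by rewrite [h *: 1]mulr1 scalerDl addrCA.
by split; rewrite ?/derivable ?/derive E.
Qed.

Lemma MVT_line {R : realType} {V : normedModType R} (u : V -> R)
    (y e : V) (s : R) :
  (forall t, `|t| <= `|s| -> derivable u (y + t *: e) e) ->
  exists2 t, `|t| <= `|s| & u (y + s *: e) - u y = s * 'D_e u (y + t *: e).
Proof.
move=> du; pose q t := u (y + t *: e).
have dq (t : R) : `|t| <= `|s| -> is_derive t 1 q ('D_e u (y + t *: e)).
  by move=> /du dut; apply: is_derive_along_line; split.
have cq (a b : R) : (forall t, t \in `[a, b] -> `|t| <= `|s|) ->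
    {within `[a, b], continuous q}.
  move=> ab; by apply: derivable_within_continuous => t /ab /dq [].
have q0 : q 0 = u y by rewrite /q scale0r addr0.
have [s0|s0|->] := ltgtP s 0; last
  by exists 0; rewrite // scale0r addr0 subrr mul0r.
- have sle t : t \in `[s, 0] -> `|t| <= `|s|.
    by rewrite in_itv/= => /andP[st t0]; rewrite !ler0_norm ?lerN2// ltW.
  have [t ts E] := MVT s0 (fun t ts => dq t (sle t (subset_itv_oo_cc ts)))
    (cq _ _ sle).
  exists t; first exact/sle/subset_itv_oo_cc.
  by rewrite -q0 -[LHS]opprB E sub0r mulrN opprK mulrC.
- have sle t : t \in `[0, s] -> `|t| <= `|s|.
    by rewrite in_itv/= => /andP[t0 ts]; rewrite !ger0_norm// ltW.
  have [t ts E] := MVT s0 (fun t ts => dq t (sle t (subset_itv_oo_cc ts)))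
    (cq _ _ sle).
  exists t; first exact/sle/subset_itv_oo_cc.
  by rewrite -q0 E subr0 mulrC.
Qed.

(** Only the step along e is handled by the mean value theorem, at the moving
    base point x + h v; this is why existence of the e-derivative is asked in a
    neighbourhood, but its continuity only at x. *)
Lemma is_derive_addr_dir {R : realType} {V : normedModType R} (u : V -> R)
    (x v e : V) (l s : R) :
  (\forall y \near x, derivable u y e) -> {for x, continuous ('D_e u)} ->
  is_derive x v u l -> is_derive x (v + s *: e) u (l + s * 'D_e u x).
Proof.
move=> du cDu [dv <-].
suff C : h^-1 *: ((u \o shift x) (h *: (v + s *: e)) - u x) @[h --> (0:R)^']
    --> 'D_v u x + s * 'D_e u x.
  split; first by apply/cvg_ex; eexists; exact: C.
  exact: cvg_lim C.
pose w h := h^-1 * (u (x + h *: v + (h * s) *: e) - u (x + h *: v)).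
have -> : (fun h : R => h^-1 *: ((u \o shift x) (h *: (v + s *: e)) - u x))
  = (fun h => h^-1 *: ((u \o shift x) (h *: v) - u x) + w h).
  apply/funext => h; rewrite /w /=.
  have -> : h *: (v + s *: e) + x = x + h *: v + (h * s) *: e.
    by rewrite scalerDr scalerA addrC addrA.
  by rewrite [h *: v + x]addrC /GRing.scale /=; ring.
apply: cvgD; first exact: dv.
apply/cvgrPdist_lt => eps eps0.
have s1 : 0 < `|s| + 1 by rewrite ltr_pwDr.
have /nbhs_normP [d /= d0 dB] : nbhs x [set y | derivable u y e /\
   `|'D_e u x - 'D_e u y| < eps / (`|s| + 1)].
  apply: filterI => //.
  by move/cvgrPdist_lt : cDu; apply; rewrite divr_gt0.
have k0 : 0 < `|v| + `|s| * `|e| + 1 by rewrite ltr_pwDr// addr_ge0// mulr_ge0.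
near=> h.
have hN0 : h != 0 by near: h; exact: nbhs_dnbhs_neq.
have hd : `|h| * (`|v| + `|s| * `|e| + 1) < d.
  rewrite -ltr_pdivlMr//; near: h; apply: dnbhs0_lt; rewrite divr_gt0//.
have inB t : `|t| <= `|h * s| -> `|x - (x + h *: v + t *: e)| < d.
  move=> ts; rewrite -[x + _ + _]addrA opprD addNKr normrN.
  apply: le_lt_trans hd; rewrite (le_trans (ler_normD _ _))// !normrZ.
  rewrite -addrA mulrDr lerD2l mulrDr mulrA -normrM mulr1.
  by rewrite (le_trans (ler_wpM2r _ ts))// lerDl.
have [t ts] := MVT_line u (x + h *: v) e (h * s)
  (fun t ts => (dB _ (inB t ts)).1).
rewrite /w => ->; rewrite -mulrA mulKf// -mulrBr normrM.
have := (dB _ (inB t ts)).2; set D := `|_ - _| => Dlt.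
apply: le_lt_trans (_ : (`|s| + 1) * D < _).
  by rewrite ler_wpM2r ?lerDl /D.
by rewrite mulrC -ltr_pdivlMr.
Unshelve. all: by end_near. Qed.

Lemma is_derive0_dir {R : realType} {V : normedModType R} (u : V -> R) (x : V) :
  is_derive x 0 u 0.
Proof.
have C : h^-1 *: ((u \o shift x) (h *: 0) - u x) @[h --> (0:R)^'] --> (0 : R).
  have -> : (fun h : R => h^-1 *: ((u \o shift x) (h *: 0) - u x)) = cst 0.
    by apply/funext => h /=; rewrite scaler0 add0r subrr scaler0.
  exact: cvg_cst.
split; first by apply/cvg_ex; exists 0.
exact: cvg_lim C.
Qed.

(** A vector is reached from 0 one coordinate at a time. *)
Lemma is_derive_partials {R : realType} {N : nat} (u : 'rV[R]_N -> R)
    (x v : 'rV[R]_N) :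
  (forall i, \forall y \near x, derivable u y (delta_mx 0 i)) ->
  (forall i, {for x, continuous (partial i u)}) ->
  is_derive x v u (\sum_i v 0 i * partial i u x).
Proof.
move=> du cu; rewrite {1}[v]row_sum_delta.
elim: (index_enum _) => [|i r IH].
  by rewrite !big_nil; exact: is_derive0_dir.
rewrite !big_cons addrC [_ * _ + _]addrC.
exact: (is_derive_addr_dir u x _ (delta_mx 0 i) _ (v 0 i) (du i) (cu i) IH).
Qed.

Lemma C1_is_derive_along_line {R : realType} {N : nat} (Omega : set 'rV[R]_N)
    (u : 'rV[R]_N -> R) (x v : 'rV[R]_N) (t : R) :
  open Omega -> C1_on Omega u -> Omega (x + t *: v) ->
  is_derive t 1 (fun s => u (x + s *: v))
    (\sum_i v 0 i * partial i u (x + t *: v)).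
Proof.
move=> oO uC1 Ox; apply: is_derive_along_line; apply: is_derive_partials => i.
  have : nbhs (x + t *: v) Omega by exact: open_nbhs_nbhs.
  by apply: filterS => y /uC1 [_ /(_ i) []].
by have [_ /(_ i) []] := uC1 _ Ox.
Qed.

(** Each partial i u is itself C1, so the first-order formula applies
    once more. *)
Lemma C2_is_derive2_along_line {R : realType} {N : nat} (Omega : set 'rV[R]_N)
    (u : 'rV[R]_N -> R) (x v : 'rV[R]_N) :
  open Omega -> C2_on Omega u -> Omega x ->
  is_derive (0 : R) 1 (fun t => \sum_i v 0 i * partial i u (x + t *: v))
    ((v *m hessian u x *m v^T) 0 0).
Proof.
move=> oO [_ duC1] Ox.
have -> : (v *m hessian u x *m v^T) 0 0
    = \sum_i v 0 i * \sum_j v 0 j * partial j (partial i u) x.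
  rewrite -mulmxA mxE; apply: eq_bigr => i _; congr (_ * _); rewrite mxE.
  by apply: eq_bigr => j _; rewrite !mxE mulrC.
have -> : (fun t => \sum_i v 0 i * partial i u (x + t *: v))
    = \sum_i (v 0 i *: (fun t => partial i u (x + t *: v))).
  by apply/funext => t; rewrite fct_sumE.
apply: is_derive_sum => i; apply: is_deriveZ.
have := @C1_is_derive_along_line _ _ _ (partial i u) x v 0 oO (duC1 i).
by rewrite scale0r addr0; exact.
Qed.

(** At a local maximum h' vanishes; if moreover l > 0, then h' > 0 on a right
    neighbourhood of 0 and h increases there. *)
Lemma second_derivative_test {R : realType} (h h' : R -> R) (l : R) :
  (\forall t \near (0 : R), is_derive (t : R) 1 h (h' t)) ->
  is_derive (0 : R) 1 h' l ->
  (\forall t \near (0 : R), h t <= h 0) -> l <= 0.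
Proof.
move=> dh dh' hmax; rewrite leNgt; apply/negP => l0.
have /nbhs_normP [d /= d0 dB] : nbhs (0 : R)
    [set t : R | is_derive (t : R) 1 h (h' t) /\ h t <= h 0] by exact: filterI.
have h'0 : h' 0 = 0.
  have [_ Dh0] : is_derive (0 : R) 1 h 0.
    apply: (@derive1_at_max _ h (- d) d).
    - by rewrite ge0_cp// ltW.
    - move=> t; rewrite in_itv/= -ltr_norml => td.
      by have [] := (dB t _).1; rewrite //= sub0r normrN.
    - by rewrite in_itv/= oppr_lt0 d0.
    - move=> t; rewrite in_itv/= -ltr_norml => td.
      by have [] := (dB t _); rewrite //= sub0r normrN.
  have [|[_ Dh0'] _] := dB 0; first by rewrite /= subrr normr0.
  by rewrite -Dh0' Dh0.
have : \forall t \near (0 : R)^', 0 < t^-1 * h' t.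
  have C : t^-1 * h' t @[t --> (0 : R)^'] --> l.
    have E : (fun t : R => t^-1 *: ((h' \o shift 0) (t *: 1) - h' 0))
        = (fun t => t^-1 * h' t).
      by apply/funext => t /=; rewrite h'0 subr0 addr0 [t *: 1]mulr1.
    by case: dh' => dh' <-; move: dh'; rewrite /derivable /derive E.
  exact: (cvgr_gt _ C).
case/nbhs_normP => e /= e0 eB.
pose b := Num.min d e / 2.
have m0 : 0 < Num.min d e by rewrite lt_min d0 e0.
have b0 : 0 < b by rewrite divr_gt0.
have bm : b < Num.min d e by rewrite ltr_pdivrMr// ltr_pMr// ltr1n.
have bd t : t \in `[0, b] -> `|0 - t| < d.
  rewrite in_itv/= sub0r normrN => /andP[t0 tb]; rewrite ger0_norm//.
  by rewrite (le_lt_trans tb)// (lt_le_trans bm)// ge_min lexx.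
have [c c0b E] : exists2 c, c \in `]0, b[ & h b - h 0 = h' c * (b - 0).
  apply: MVT => //.
    by move=> t /subset_itv_oo_cc /bd td; have [] := dB t td.
  apply: derivable_within_continuous => t /bd td.
  by have [[]] := dB t td.
have c0 : 0 < c by rewrite (itvP c0b).
have ce : c < e.
  have : c < Num.min d e by rewrite (lt_trans _ bm)// (itvP c0b).
  by rewrite lt_min => /andP[].
have h'c : 0 < h' c.
  have := eB c; rewrite /= sub0r normrN gtr0_norm// pmulr_rgt0 ?invr_gt0//.
  by apply=> //; rewrite gt_eqF.
have [] := dB b (bd b _); first by rewrite in_itv/= lexx ltW.
by move=> _; rewrite -subr_le0 E subr0 leNgt mulr_gt0.
Qed.

(** * Interior maxima of the difference with a separable barrier *)

Lemma is_derive_comp_affine {R : realType} (q : R -> R) (a b t l : R) :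
  is_derive (a + t * b) 1 q l -> is_derive t 1 (fun s => q (a + s * b)) (b * l).
Proof.
move=> dq; have da : is_derive t 1 (fun s => a + s * b) b.
  have := @is_deriveD _ _ _ _ _ t 1 0 _ (is_derive_cst a t 1)
    (@is_deriveZ _ _ _ _ b _ _ _ (is_derive_id t 1)).
  rewrite add0r [b *: 1]mulr1; congr is_derive.
  by apply/funext => s; rewrite /cst /= mulrC.
by have := @is_derive1_comp _ q (fun s => a + s * b) t _ _ dq da; rewrite mulrC.
Qed.

(** The maximum of u - w is taken over the smaller closed cube K of half-side
    rho, outside which the blow-up of q already gives w > u; it is therefore a
    maximum over the whole open cube, hence interior. *)
Lemma exists_touching_point {R : realType} {N : nat} (Omega : set 'rV[R]_N)
    (u : 'rV[R]_N -> R) (x0 x : 'rV[R]_N) (r : R) (q q' q2 : R -> R) :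
  open Omega -> C2_on Omega u -> compactly_contained (cube x0 r) Omega ->
  (forall s, `|s| < r -> 0 <= q s) ->
  (forall s : R, `|s| < r -> is_derive s 1 q (q' s)) ->
  (forall s : R, `|s| < r -> is_derive s 1 q' (q2 s)) ->
  (forall U, exists2 rho, rho < r & forall s, rho < `|s| < r -> U < q s) ->
  cube x0 r x -> \sum_i q (x 0 i - x0 0 i) < u x ->
  exists z, [/\ cube x0 r z, \sum_i q (z 0 i - x0 0 i) < u z &
    forall v : 'rV_N, (v *m hessian u z *m v^T) 0 0
      <= \sum_i q2 (z 0 i - x0 0 i) * v 0 i ^+ 2].
Proof.
move=> oO uC2 [cptQ QO] q_ge0 dq dq' blowup Qx wux.
set w := fun y : 'rV[R]_N => \sum_i q (y 0 i - x0 0 i).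
have QsubO y : cube x0 r y -> Omega y by move=> Qy; exact/QO/subset_closure.
have cu y : Omega y -> {for y, continuous u} by move=> /uC2.1 [].
have [U uU] : exists U, forall y, cube x0 r y -> u y <= U.
  have [c _ cmax] : exists2 c, c \in closure (cube x0 r) &
      forall t, t \in closure (cube x0 r) -> u t <= u c.
    apply: EVT_max_rV => //; first by exists x; exact: subset_closure.
    by apply: continuous_in_subspaceT => y; rewrite inE => /QO /cu.
  by exists (u c) => y Qy; apply: cmax; rewrite inE; exact: subset_closure.
have [rho rhor rhoU] := blowup U.
have big y i : cube x0 r y -> rho < `|y 0 i - x0 0 i| -> u y < w y.
  move=> Qy yi; apply: le_lt_trans (uU y Qy) _.
  rewrite /w (bigD1 i)//= ltr_wpDr//; last by rewrite rhoU// yi Qy.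
  by apply: sumr_ge0 => j _; rewrite q_ge0// Qy.
pose K := [set y : 'rV[R]_N | forall i, `|y 0 i - x0 0 i| <= rho].
have KQ y : K y -> cube x0 r y by move=> Ky i; exact: le_lt_trans rhor.
have cK : compact K.
  pose I i : set R := `[x0 0 i - rho, x0 0 i + rho]%classic.
  have -> : K = [set y | forall i, I i (y ord0 i)].
    by apply/seteqP; split=> y Ky i; move: (Ky i);
      rewrite /I /= in_itv/= distrC ler_distlC.
  by apply: rV_compact => i; exact: segment_compact.
have inK y : cube x0 r y -> w y < u y -> K y.
  move=> Qy wuy i; rewrite leNgt; apply/negP => /(big y i Qy) /(lt_trans wuy).
  by rewrite ltxx.
have cw y : cube x0 r y -> {for y, continuous w}.
  move=> Qy.
  suff : forall s : seq 'I_N, {for y, continuous (fun y : 'rV[R]_N =>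
      \sum_(i <- s) q (y 0 i - x0 0 i))} by exact.
  elim=> [|i s IH].
    rewrite (_ : (fun _ => _) = cst 0); first exact: cst_continuous.
    by apply/funext => y'; rewrite big_nil.
  rewrite (_ : (fun _ => _) = (fun y : 'rV[R]_N => q (y 0 i - x0 0 i)
    + \sum_(i <- s) q (y 0 i - x0 0 i))); last first.
    by apply/funext => y'; rewrite big_cons.
  have cq : {for y 0 i - x0 0 i, continuous q}.
    apply: differentiable_continuous; apply/derivable1_diffP.
    by have [] := dq _ (Qy i).
  have ci : {for y, continuous (fun y' : 'rV[R]_N => y' 0 i - x0 0 i)}.
    by apply: continuousB; [exact: coord_continuous|exact: cst_continuous].
  have cqi : {for y, continuous (fun y' : 'rV[R]_N => q (y' 0 i - x0 0 i))}.
    exact: continuous_comp ci cq.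
  exact: continuousD cqi IH.
have [z Kz zmax] : exists2 z, z \in K &
    forall t, t \in K -> u t - w t <= u z - w z.
  apply: EVT_max_rV => //; first by exists x; exact: inK.
  apply: continuous_in_subspaceT => y; rewrite inE => /KQ Qy.
  by apply: continuousB; [exact/cu/QsubO|exact: cw].
rewrite inE in Kz; have Qz := KQ z Kz.
have wuz : w z < u z.
  have := zmax x; rewrite inE => /(_ (inK x Qx wux)).
  by rewrite -subr_gt0; apply: lt_le_trans; rewrite subr_gt0.
have gmax y : cube x0 r y -> u y - w y <= u z - w z.
  move=> Qy; have [uw|wu] := leP (u y) (w y).
    by apply: (@le_trans _ _ 0); rewrite ?subr_le0// subr_ge0 ltW.
  by apply: zmax; rewrite inE; exact: inK.
exists z; split=> // v.
have nearQ : \forall t \near (0 : R), cube x0 r (z + t *: v).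
  suff nearQi i : \forall t \near (0 : R), `|(z + t *: v) 0 i - x0 0 i| < r.
    exact: filter_forall nearQi.
  have C : `|z 0 i + t * v 0 i - x0 0 i| @[t --> (0 : R)]
      --> `|z 0 i + 0 * v 0 i - x0 0 i|.
    apply: cvg_norm; apply: cvgB; last exact: cvg_cst.
    apply: cvgD; first exact: cvg_cst.
    by apply: cvgM; [exact: cvg_id|exact: cvg_cst].
  have := cvgr_lt _ C; rewrite mul0r addr0 => /(_ _ _ (Qz i)).
  by apply: filterS => t; rewrite !mxE.
rewrite -subr_le0.
apply: (@second_derivative_test _
  (fun t => u (z + t *: v) - \sum_i q ((z 0 i - x0 0 i) + t * v 0 i))
  (fun t => \sum_i v 0 i * partial i u (z + t *: v)
     - \sum_i v 0 i * q' ((z 0 i - x0 0 i) + t * v 0 i))).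
- apply: filterS nearQ => t Qt; apply: is_deriveB.
    exact: C1_is_derive_along_line oO uC2.1 (QsubO _ Qt).
  rewrite (_ : (fun t => _) =
    \sum_i (fun t => q (z 0 i - x0 0 i + t * v 0 i))); last first.
    by apply/funext => s; rewrite fct_sumE.
  apply: is_derive_sum => i; apply: is_derive_comp_affine.
  by apply: dq; have := Qt i; rewrite !mxE addrAC.
- apply: is_deriveB; first exact: C2_is_derive2_along_line oO uC2 (QsubO _ Qz).
  rewrite (_ : (fun t => _) =
    \sum_i (v 0 i *: (fun t => q' (z 0 i - x0 0 i + t * v 0 i)))); last first.
    by apply/funext => s; rewrite fct_sumE.
  apply: is_derive_sum => i.
  have -> : q2 (z 0 i - x0 0 i) * v 0 i ^+ 2
      = v 0 i *: (v 0 i * q2 (z 0 i - x0 0 i)).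
    by rewrite /GRing.scale /=; ring.
  apply: is_deriveZ; apply: is_derive_comp_affine; rewrite mul0r addr0.
  exact/dq'/Qz.
- apply: filterS nearQ => t /gmax; rewrite scale0r addr0.
  rewrite /w; congr (_ - _ <= _ - _); apply: eq_bigr => i _.
    by rewrite !mxE addrAC.
  by rewrite mul0r addr0.
Qed.

(** * Bounded domains *)

Lemma normr_coord_le {R : realType} {N : nat} (z : 'rV[R]_N) (i : 'I_N) :
  `|z 0 i| <= `|z|.
Proof.
rewrite [leRHS]/Num.norm /= mx_normrE.
by apply/bigmax_geP; right; exists (0, i).
Qed.

Lemma enorm_le {R : realType} {N : nat} (z : 'rV[R]_N) :
  enorm z <= N.+1%:R * `|z|.
Proof.
have z0 : 0 <= N.+1%:R * `|z| by rewrite mulr_ge0.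
rewrite -[leRHS]ger0_norm// -sqrtr_sqr ler_wsqrtr//.
apply: (@le_trans _ _ (N%:R * `|z| ^+ 2)).
  have -> : N%:R * `|z| ^+ 2 = \sum_(i < N) `|z| ^+ 2.
    by rewrite sumr_const card_ord mulr_natl.
  apply: ler_sum => i _.
  by rewrite -real_normK ?num_real// lerXn2r ?nnegrE// normr_coord_le.
rewrite exprMn ler_wpM2r ?sqr_ge0// -natrX ler_nat.
by rewrite (leq_trans (leqnSn N))// expnS leq_pmulr// expn_gt0.
Qed.

Lemma bounded_sub_compact {R : realType} {N : nat} (Omega : set 'rV[R]_N) :
  bounded_set Omega -> exists2 M, 0 < M &
    Omega `<=` [set y | forall i, `|y 0 i| <= M] /\
    compact [set y : 'rV[R]_N | forall i, `|y 0 i| <= M].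
Proof.
move=> [M0 [_ OM]]; pose M := Num.max 1 (M0 + 1); exists M.
  by rewrite lt_max ltr01.
split.
  move=> y Oy i; apply: le_trans (normr_coord_le y i) _.
  by rewrite (le_trans (OM (M0 + 1) _ y Oy)) ?ltrDl// le_max lexx orbT.
have -> : [set y : 'rV[R]_N | forall i, `|y 0 i| <= M]
    = [set y | forall i, (`[- M, M]%classic : set R) (y ord0 i)].
  by apply/seteqP; split=> y My i; move: (My i); rewrite /= in_itv/= ler_norml.
apply: (@rV_compact _ _ (fun=> `[- M, M]%classic)) => i.
exact: segment_compact.
Qed.

(** Locally, either Omega is absent or f is within 1 of one of its values;
    compactness turns local bounds into a global one. *)
Lemma uniformly_continuous_bounded {R : realType} {N : nat}
    (Omega : set 'rV[R]_N) (f : 'rV[R]_N -> R) :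
  bounded_set Omega -> uniformly_continuous_on Omega f ->
  exists F, forall x, Omega x -> f x <= F.
Proof.
move=> /bounded_sub_compact [M _ [OK /compact_near_coveringP cK]] ucf.
have [d d0 fd] := ucf 1 ltr01.
(* Two points within e of a third are at Euclidean distance less than d. *)
pose e := d / N.+1%:R / 2.
have e0 : 0 < e by rewrite !divr_gt0.
have : \forall F \near +oo, [set y : 'rV[R]_N | forall i, `|y 0 i| <= M]
    `<=` (fun y => Omega y -> f y <= F).
  apply: (cK R +oo (fun F y => Omega y -> f y <= F)) => y _.
  have [[z [Oz yz]]|none] := pselect (exists z, Omega z /\ `|y - z| < e).
    exists (ball y e, [set F | f z + 1 <= F]) => /=.
      split; first exact: nbhsx_ballx.
      by apply: nbhs_pinfty_ge; exact: num_real.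
    move=> [x F] /= [yx fzF] Ox.
    have : `|f x - f z| < 1.
      apply: fd => //; apply: le_lt_trans (enorm_le _) _.
      rewrite -ltr_pdivlMl// mulrC [ltRHS](splitr (d / N.+1%:R)) -/e.
      rewrite -(subrKA y) (le_lt_trans (ler_normD _ _))// ltrD//.
      by rewrite distrC; move: yx; rewrite -ball_normE.
    by rewrite ltr_norml => /andP[_]; lra.
  exists (ball y e, setT) => /=.
    by split; [exact: nbhsx_ballx|exact: filterT].
  move=> [x F] /= [yx _] Ox; exfalso; apply: none; exists x; split=> //.
  by move: yx; rewrite -ball_normE.
move=> [F0 [_ FK]]; exists (F0 + 1) => x Ox; apply: (FK (F0 + 1)) => //.
  by rewrite ltrDl.
exact: OK.
Qed.

Lemma cube_radius_bounded {R : realType} {N : nat} (Omega : set 'rV[R]_N) :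
  (0 < N)%N -> bounded_set Omega ->
  exists2 D, 0 < D & forall x0 r, 0 < r -> cube x0 r `<=` Omega -> r <= D.
Proof.
move=> N0 /bounded_sub_compact [M M0 [OM _]]; exists (4 * M).
  by rewrite mulr_gt0.
move=> x0 r r0 QO; pose i := Ordinal N0.
have : `|x0 0 i| <= M.
  by apply: OM; apply: QO => j; rewrite subrr normr0.
have : `|x0 0 i + r / 2| <= M.
  have /OM/(_ i) : Omega (x0 + const_mx (r / 2)).
    apply: QO => j; rewrite !mxE addrAC subrr add0r gtr0_norm; lra.
  by rewrite !mxE.
rewrite !ler_norml; lra.
Qed.

(** * Integrals over half-lines *)

Local Notation mu := lebesgue_measure.

Definition tail {R : realType} (g : R -> R) (t : R) : R :=
  \int[mu]_(s in `[t, +oo[) g s.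

Lemma integrable_setU_disjoint d (T : measurableType d) (R : realType)
    (nu : {measure set T -> \bar R}) (A B : set T) (f : T -> \bar R) :
  measurable A -> measurable B -> [disjoint A & B] ->
  nu.-integrable A f -> nu.-integrable B f -> nu.-integrable (A `|` B) f.
Proof.
move=> mA mB AB /integrableP[mAf Af] /integrableP[mBf Bf].
have mU : measurable_fun (A `|` B) f by apply/measurable_funU.
apply/integrableP; split=> //.
rewrite ge0_integral_setU//; last exact: measurableT_comp.
by rewrite lte_add_pinfty.
Qed.

Lemma continuous_itvcc_integrable {R : realType} (g : R -> R) (t a : R) :
  (forall s, t <= s -> {for s, continuous g}) ->
  mu.-integrable `[t, a] (EFin \o g).
Proof.
move=> cg; apply: continuous_compact_integrable; first exact: segment_compact.
apply: continuous_in_subspaceT => s; rewrite inE/= in_itv/= => /andP[ts _].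
exact: cg.
Qed.

(** The integral of a continuous function near a finite endpoint is harmless. *)
Lemma tail_integrable {R : realType} (g : R -> R) (t a : R) :
  (forall s, t <= s -> {for s, continuous g}) ->
  mu.-integrable `[a, +oo[ (EFin \o g) -> mu.-integrable `[t, +oo[ (EFin \o g).
Proof.
move=> cg ig; have [at_|ta] := leP a t.
  apply: integrableS ig => //; apply: subset_itvr; by rewrite bnd_simp.
have D : [disjoint `[t, a[%classic & `[a, +oo[%classic].
  apply/disj_setPS => s [/=]; rewrite !in_itv/= => /andP[_ sa]; rewrite andbT.
  by rewrite leNgt sa.
have U : `[t, +oo[%classic = `[t, a[ `|` `[a, +oo[.
  by rewrite -itv_bndbnd_setU ?bnd_simp// ltW.
have i1 : mu.-integrable `[t, a[ (EFin \o g).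
  have := continuous_itvcc_integrable g t a cg; apply: integrableS => //.
  by apply: subset_itvl; rewrite bnd_simp.
by rewrite U; exact: integrable_setU_disjoint.
Qed.

(** On a neighbourhood of t the tail is a constant minus the integral from a
    fixed b < t, to which the fundamental theorem applies. *)
Lemma is_derive_tail {R : realType} (g : R -> R) (a t : R) : a < t ->
  (forall s, a < s -> {for s, continuous g}) ->
  (forall s, a < s -> mu.-integrable `[s, +oo[ (EFin \o g)) ->
  is_derive t 1 (tail g) (- g t).
Proof.
move=> at_ cg ig; pose b := (a + t) / 2.
have ab : a < b by rewrite /b; lra.
have bt : b < t by rewrite /b; lra.
have near_eq : \forall s \near t,
    cst (tail g b) s - \int[mu]_(y in `[b, s]) g y = tail g s.
  near=> s; rewrite /= /tail Rintegral_itvB ?bnd_simp//; last 2 first.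
  - exact: ig.
  - by rewrite ltW//; near: s; exact: lt_nbhsr.
  rewrite Rintegral_itv_obnd_cbnd//.
  apply: integrableS (ig _ ab) => //; apply: subset_itvr; rewrite bnd_simp.
  by rewrite ltW//; near: s; exact: lt_nbhsr.
apply: near_eq_is_derive near_eq _.
rewrite -[- g t]add0r; apply: is_deriveB.
have t1 : t < t + 1 by rewrite ltrDl.
have [|dF <-] := continuous_FTC1_closed t1 _ bt (cg _ at_).
  apply: continuous_itvcc_integrable => s bs; apply: cg.
  exact: lt_le_trans bs.
by rewrite derive1E; split.
Unshelve. all: by end_near. Qed.

(** Dominated convergence for the truncations of g to [n, +oo[. *)
Lemma tail_lt_eps {R : realType} (g : R -> R) (a e : R) : 0 < e ->
  mu.-integrable `[a, +oo[ (EFin \o g) ->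
  exists2 t, a <= t & `|tail g t| < e.
Proof.
move=> e0 ig; pose D : set R := `[a, +oo[%classic.
pose f_ (n : nat) : R -> \bar R := (EFin \o g) \_ `[n%:R, +oo[%classic.
have mD : measurable D by exact: measurable_itv.
have /integrableP[mg _] := ig.
have [|||||_ _] := @dominated_convergence _ _ _ mu D mD f_ (cst 0%E)
  (abse \o (EFin \o g)).
- move=> n; apply/measurable_restrict => //.
  by apply: measurable_funS mg => // x [].
- exact: measurable_cst.
- apply: aeW => x _ Dx; apply: cvg_near_cst.
  near=> n; rewrite /f_ patchE memNset//= in_itv/= andbT.
  apply/negP; rewrite -ltNge.
  by near: n; exact: nbhs_infty_gtr.
- exact: integrable_abse.
- apply: aeW => x n Dx; rewrite /f_ patchE; case: ifP => //= _.
  by rewrite normr0 lee_fin.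
rewrite integral0 => cv.
have f_E n : a <= n%:R -> (\int[mu]_(x in D) f_ n x)%E = (tail g n%:R)%:E.
  move=> an; rewrite -integral_mkcondr.
  have -> : D `&` `[n%:R, +oo[ = `[n%:R, +oo[%classic.
    by apply/setIidr => x; rewrite /D /= !in_itv/= !andbT; exact: (le_trans an).
  rewrite /tail /Rintegral fineK//; apply: integrable_fin_num => //.
  by apply: integrableS ig => //; apply: subset_itvr; rewrite bnd_simp.
have cvf : fine (\int[mu]_(x in D) f_ n x)%E @[n --> \oo] --> (0 : R).
  exact: fine_cvg cv.
have near_lt : \forall n \near \oo,
    `|0 - fine (\int[mu]_(x in D) f_ n x)%E| < e.
  by move/cvgrPdist_lt : cvf; apply.
have [n [an ne]] : exists n : nat, a <= n%:R /\
    `|0 - fine (\int[mu]_(x in D) f_ n x)%E| < e.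
  near \oo => n; exists n; split; first by near: n; exact: nbhs_infty_ger.
  by near: n; exact: near_lt.
by exists n%:R => //; rewrite -normrN -sub0r; rewrite f_E in ne.
Unshelve. all: by end_near. Qed.

(** * The primitive of beta, the function Phi and its inverse *)

(** The second and third clauses make beta nonnegative on [0, +oo[. *)
Definition absorption {R : realType} (beta : R -> R) : Prop :=
  [/\ {within [set` `[0, +oo[], continuous beta},
      (forall s t, 0 <= s -> s < t -> beta s < beta t),
      beta 0 = 0 & Keller_Osserman beta].

Lemma beta_gt0 {R : realType} (beta : R -> R) (s : R) :
  absorption beta -> 0 < s -> 0 < beta s.
Proof. by case=> _ incr b0 _ s0; rewrite -b0 incr. Qed.

Lemma beta_le {R : realType} (beta : R -> R) (s t : R) :
  absorption beta -> 0 <= s -> s <= t -> beta s <= beta t.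
Proof.
case=> _ incr _ _ s0; rewrite le_eqVlt => /predU1P[->//|st].
by rewrite ltW// incr.
Qed.

Lemma beta_continuous_pos {R : realType} (beta : R -> R) (s : R) :
  absorption beta -> 0 < s -> {for s, continuous beta}.
Proof.
case=> cb _ _ _ s0; apply: (@within_continuous_continuous _ _ _ 0 (s + 1)).
- exact: addr_gt0.
- by apply: continuous_subspaceW cb; apply: subset_itvl; rewrite bnd_simp.
- by rewrite in_itv/= s0 ltrDl ltr01.
Qed.

Lemma beta_integrable {R : realType} (beta : R -> R) (s : R) :
  absorption beta -> mu.-integrable `[0, s] (EFin \o beta).
Proof.
case=> cb _ _ _; apply: continuous_compact_integrable.
  exact: segment_compact.
by apply: continuous_subspaceW cb; apply: subset_itvl; rewrite bnd_simp.
Qed.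

Lemma is_derive_primitive {R : realType} (beta : R -> R) (s : R) :
  absorption beta -> 0 < s -> is_derive s 1 (primitive beta) (beta s).
Proof.
move=> ab s0; have s1 : s < s + 1 by rewrite ltrDl.
have [dG <-] := continuous_FTC1_closed s1 (beta_integrable beta (s + 1) ab) s0
  (beta_continuous_pos beta s ab s0).
by rewrite derive1E; split.
Qed.

Lemma primitive_le {R : realType} (beta : R -> R) (s : R) :
  absorption beta -> 0 <= s -> primitive beta s <= s * beta s.
Proof.
move=> ab s0.
have -> : s * beta s = \int[mu]_(x in `[0, s]) cst (beta s) x.
  rewrite Rintegral_cst//= lebesgue_measure_itv/=.
  by move: s0; rewrite le_eqVlt lte_fin => /predU1P[<-|s0];
    rewrite ?ltxx ?s0 /= ?subr0 ?mul0r ?mulr0// mulrC.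
apply: le_Rintegral => //; first exact: beta_integrable.
  by apply: continuous_itvcc_integrable => x _; exact: cst_continuous.
by move=> x /=; rewrite in_itv/= => /andP[x0]; exact: beta_le.
Qed.

Lemma primitive_incr {R : realType} (beta : R -> R) (s t : R) :
  absorption beta -> 0 < s -> s < t -> primitive beta s < primitive beta t.
Proof.
move=> ab s0 st.
have dG (x : R) : 0 < x -> is_derive x 1 (primitive beta) (beta x).
  exact: is_derive_primitive.
have [c cst E] : exists2 c, c \in `]s, t[ &
    primitive beta t - primitive beta s = beta c * (t - s).
  apply: MVT => //.
    by move=> x; rewrite in_itv/= => /andP[/(lt_trans s0) /dG].
  apply: derivable_within_continuous => x; rewrite in_itv/= => /andP[sx _].
  by have [] := dG x (lt_le_trans s0 sx).
rewrite -subr_gt0 E mulr_gt0 ?subr_gt0// beta_gt0// (lt_trans s0)//.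
by rewrite (itvP cst).
Qed.

Lemma primitive_gt0 {R : realType} (beta : R -> R) (s : R) :
  absorption beta -> 0 < s -> 0 < primitive beta s.
Proof.
move=> ab s0; have s2 : 0 < s / 2 by rewrite divr_gt0.
apply: le_lt_trans (primitive_incr beta (s / 2) s ab s2 _); last first.
  by rewrite ltr_pdivrMr// ltr_pMr// ltr1n.
apply: Rintegral_ge0 => x; rewrite /= in_itv/= => /andP[x0 _].
by have [_ _ <- _] := ab; exact: beta_le.
Qed.

(** The inverse phi of Phi solves phi' = - speed (phi). *)
Definition speed {R : realType} (beta : R -> R) (s : R) : R :=
  Num.sqrt (2 * primitive beta s).

Lemma speed_gt0 {R : realType} (beta : R -> R) (s : R) :
  absorption beta -> 0 < s -> 0 < speed beta s.
Proof. by move=> ab s0; rewrite sqrtr_gt0 mulr_gt0// primitive_gt0. Qed.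

(** Differentiating speed ^ 2 = 2 G gives speed' * speed = beta. *)
Lemma is_derive_speed {R : realType} (beta : R -> R) (s : R) :
  absorption beta -> 0 < s ->
  is_derive s 1 (speed beta) (beta s / speed beta s).
Proof.
move=> ab s0; have G0 := primitive_gt0 beta s ab s0.
have d2G : is_derive s 1 (fun x => 2 * primitive beta x) (2 * beta s).
  by have := @is_deriveZ _ _ _ _ 2 _ _ _ (is_derive_primitive beta s ab s0).
have := @is_derive1_comp _ Num.sqrt _ _ _ _ (is_derive1_sqrt _) d2G.
move=> /(_ (mulr_gt0 (ltr0Sn _ 1) G0)).
rewrite (_ : _^-1 * _ = beta s / speed beta s)// /speed.
by rewrite invfM mulrACA mulVf ?pnatr_eq0// mul1r mulrC.
Qed.

Lemma inv_speed_continuous {R : realType} (beta : R -> R) (s : R) :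
  absorption beta -> 0 < s -> {for s, continuous (fun x => (speed beta x)^-1)}.
Proof.
move=> ab s0; apply: cvgV; first by rewrite gt_eqF// speed_gt0.
apply: differentiable_continuous; apply/derivable1_diffP.
by have [] := is_derive_speed beta s ab s0.
Qed.

Lemma inv_speed_integrable {R : realType} (beta : R -> R) (t : R) :
  absorption beta -> 0 < t ->
  mu.-integrable `[t, +oo[ (EFin \o (fun x => (speed beta x)^-1)).
Proof.
move=> ab t0; have [_ _ _ [a a0 KO]] := ab.
apply: (@tail_integrable _ _ t a).
  by move=> s ts; apply: inv_speed_continuous => //; exact: lt_le_trans ts.
have mg : measurable_fun `[a, +oo[ (fun x => (speed beta x)^-1).
  apply: subspace_continuous_measurable_fun; first exact: measurable_itv.
  apply: continuous_in_subspaceT => s; rewrite inE/= in_itv/= andbT => as_.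
  by apply: inv_speed_continuous => //; exact: lt_le_trans as_.
apply/integrableP; split; first exact/measurable_EFinP.
apply: le_lt_trans KO.
have -> : (\int[mu]_(s in `[a, +oo[) ((Num.sqrt (primitive beta s))^-1)%:E =
    \int[mu]_(s in `[a, +oo[) (Num.sqrt 2 * (speed beta s)^-1)%:E)%E.
  apply: eq_integral => s _; congr (_%:E).
  by rewrite /speed sqrtrM// invfM mulrA divff ?mul1r// gt_eqF// sqrtr_gt0.
apply: ge0_le_integral => //.
- by apply: measurableT_comp => //; exact/measurable_EFinP.
- by apply/measurable_EFinP; exact: measurable_funM.
move=> s _; rewrite /= lee_fin ger0_norm ?invr_ge0 ?sqrtr_ge0//.
by rewrite ler_peMl ?invr_ge0 ?sqrtr_ge0// -[leLHS]sqrtr1 ler_wsqrtr// ler1n.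
Qed.

(** Phi is by definition the tail of 1 / speed. *)
Lemma is_derive_Phi {R : realType} (beta : R -> R) (t : R) :
  absorption beta -> 0 < t -> is_derive t 1 (Phi beta) (- (speed beta t)^-1).
Proof.
move=> ab t0; apply: (@is_derive_tail _ (fun x => (speed beta x)^-1) 0) => //.
- by move=> s; exact: inv_speed_continuous.
- by move=> s; exact: inv_speed_integrable.
Qed.

Lemma Phi_MVT {R : realType} (beta : R -> R) (s t : R) :
  absorption beta -> 0 < s -> s < t ->
  exists2 c, s < c < t & Phi beta s - Phi beta t = (t - s) / speed beta c.
Proof.
move=> ab s0 st.
have dP (x : R) : 0 < x -> is_derive x 1 (Phi beta) (- (speed beta x)^-1).
  exact: is_derive_Phi.
have [c cst E] : exists2 c, c \in `]s, t[ &
    Phi beta t - Phi beta s = - (speed beta c)^-1 * (t - s).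
  apply: (@MVT _ (Phi beta) (fun x => - (speed beta x)^-1)) => //.
    by move=> x; rewrite in_itv/= => /andP[/(lt_trans s0) /dP].
  apply: derivable_within_continuous => x; rewrite in_itv/= => /andP[sx _].
  by have [] := dP x (lt_le_trans s0 sx).
exists c; first by rewrite in_itv/= in cst.
by rewrite -opprB E mulNr opprK mulrC.
Qed.

Lemma Phi_decr {R : realType} (beta : R -> R) (s t : R) :
  absorption beta -> 0 < s -> s < t -> Phi beta t < Phi beta s.
Proof.
move=> ab s0 st; have [c /andP[sc _] E] := Phi_MVT beta s t ab s0 st.
by rewrite -subr_gt0 E divr_gt0 ?subr_gt0 ?speed_gt0// (lt_trans s0).
Qed.

Lemma Phi_ge0 {R : realType} (beta : R -> R) (t : R) : 0 <= Phi beta t.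
Proof. by apply: Rintegral_ge0 => s _; rewrite invr_ge0 sqrtr_ge0. Qed.

Lemma Phi_gt0 {R : realType} (beta : R -> R) (t : R) :
  absorption beta -> 0 < t -> 0 < Phi beta t.
Proof.
move=> ab t0; apply: le_lt_trans (Phi_ge0 beta (t + 1)) _.
by apply: Phi_decr => //; rewrite ltrDl.
Qed.

Lemma Phi_inj {R : realType} (beta : R -> R) : absorption beta ->
  {in (`]0, +oo[%classic : set R) &, injective (Phi beta)}.
Proof.
move=> ab s t; rewrite !inE/= !in_itv/= !andbT => s0 t0.
have [st|ts|//] := ltgtP s t.
- by have := Phi_decr beta s t ab s0 st => /[swap] ->; rewrite ltxx.
- by have := Phi_decr beta t s ab t0 ts => /[swap] ->; rewrite ltxx.
Qed.

Lemma Phi_invK {R : realType} (beta : R -> R) (t : R) : absorption beta ->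
  0 < t -> Phi_inv beta (Phi beta t) = t.
Proof.
move=> ab t0; apply: pinvKV; first exact: Phi_inj.
by rewrite inE/= in_itv/= t0.
Qed.

(** Phi decreases continuously to 0, so the intermediate value theorem applies
    between 1 and a far away point. *)
Lemma Phi_surj {R : realType} (beta : R -> R) (tau : R) : absorption beta ->
  0 < tau -> tau <= Phi beta 1 -> exists2 t, 1 <= t & Phi beta t = tau.
Proof.
move=> ab tau0 taule.
have [T T1 PT] := @tail_lt_eps _ (fun x => (speed beta x)^-1) 1 tau tau0
  (inv_speed_integrable beta 1 ab ltr01).
have PTtau : Phi beta T < tau by rewrite (le_lt_trans (ler_norm _)).
have /IVT[] // : Num.min (Phi beta 1) (Phi beta T) <= tau
    <= Num.max (Phi beta 1) (Phi beta T).
- by rewrite ge_min le_max taule (ltW PTtau) orbT.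
- apply: derivable_within_continuous => x; rewrite in_itv/= => /andP[x1 _].
  by have [] := is_derive_Phi beta x ab (lt_le_trans ltr01 x1).
- by move=> t; rewrite in_itv/= => /andP[t1 _] <-; exists t.
Qed.

Lemma Phi_inv_spec {R : realType} (beta : R -> R) (tau : R) : absorption beta ->
  0 < tau -> tau <= Phi beta 1 ->
  1 <= Phi_inv beta tau /\ Phi beta (Phi_inv beta tau) = tau.
Proof.
move=> ab tau0 taule; have [t t1 <-] := Phi_surj beta tau ab tau0 taule.
by rewrite Phi_invK// (lt_le_trans ltr01).
Qed.

(** The limit at 0+ of the decreasing function Phi is its supremum, already
    larger than Phi (1/2) > Phi 1. *)
Lemma Phi1_lt_Phi0 {R : realType} (beta : R -> R) :
  absorption beta -> ((Phi beta 1)%:E < Phi0 beta)%E.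
Proof.
move=> ab; have h0 : 0 < 2^-1 :> R by rewrite invr_gt0.
apply: (@lt_le_trans _ _ (Phi beta 2^-1)%:E).
  by rewrite lte_fin Phi_decr// invf_lt1// ltr1n.
rewrite /Phi0.
have -> := cvg_lim _ (@nonincreasing_at_right_cvge _ (EFin \o Phi beta) 0
  +oo%O _ _) => //.
- by apply: ereal_sup_ubound; exists 2^-1 => //=; rewrite in_itv/= h0.
move=> s t; rewrite !in_itv/= !andbT => s0 t0.
rewrite le_eqVlt => /predU1P[->//|st].
by rewrite lee_fin ltW// Phi_decr.
Qed.

Lemma is_derive_Phi_inv {R : realType} (beta : R -> R) (t : R) :
  absorption beta -> 0 < t ->
  is_derive (Phi beta t) 1 (Phi_inv beta) (- speed beta t).
Proof.
move=> ab t0.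
have pos : \forall s \near t, 0 < s by exact: lt_nbhsr.
have sp0 := speed_gt0 beta t ab t0.
rewrite -[- speed beta t]invrK invrN; apply: is_derive_inverse.
- by apply: filterS pos => s s0; exact: Phi_invK.
- apply: filterS pos => s s0; apply: differentiable_continuous.
  by apply/derivable1_diffP; have [] := is_derive_Phi beta s ab s0.
- exact: is_derive_Phi.
- by rewrite oppr_eq0 invr_eq0 gt_eqF.
Qed.

(** This is phi'' = beta (phi), in the form (speed (phi))' = - beta (phi). *)
Lemma is_derive_speed_Phi_inv {R : realType} (beta : R -> R) (t : R) :
  absorption beta -> 0 < t ->
  is_derive (Phi beta t) 1 (fun x => speed beta (Phi_inv beta x)) (- beta t).
Proof.
move=> ab t0; have sp0 := speed_gt0 beta t ab t0.
have d1 := is_derive_Phi_inv beta t ab t0.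
have d2 : is_derive (Phi_inv beta (Phi beta t)) 1 (speed beta)
    (beta t / speed beta t).
  by rewrite Phi_invK//; exact: is_derive_speed.
have := @is_derive1_comp _ _ _ _ _ _ d2 d1.
by rewrite mulrN divfK// gt_eqF.
Qed.

(** On [s/2, s] the mean value theorem gives s / 2 <= Phi (1/2) * speed s, while
    speed s ^ 2 = 2 G s <= 2 s beta s; squaring, s is at most a multiple of
    beta s. *)
Lemma linear_le_beta {R : realType} (beta : R -> R) : absorption beta ->
  exists2 C, 0 < C & forall s, 1 <= s -> s <= C * beta s.
Proof.
move=> ab; have h0 : 0 < 2^-1 :> R by rewrite invr_gt0.
have P0 := Phi_gt0 beta _ ab h0.
exists (8 * Phi beta 2^-1 ^+ 2); first by rewrite mulr_gt0// exprn_gt0.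
move=> s s1; have s0 : 0 < s by rewrite (lt_le_trans ltr01).
have s20 : 0 < s / 2 by rewrite divr_gt0.
have [|c /andP[sc cs] E] := Phi_MVT beta (s / 2) s ab s20; first by lra.
have c0 : 0 < c by rewrite (lt_trans s20).
have le1 : s / 2 / speed beta c <= Phi beta 2^-1.
  have -> : s / 2 / speed beta c = Phi beta (s / 2) - Phi beta s.
    by rewrite E; congr (_ / _); lra.
  have : Phi beta (s / 2) <= Phi beta 2^-1.
    have [->|ne] := eqVneq s 1; first by rewrite mul1r.
    by rewrite ltW// Phi_decr// -[ltLHS]mul1r ltr_pM2r// lt_def ne.
  have := Phi_ge0 beta s; lra.
have le2 : s / 2 <= Phi beta 2^-1 * speed beta c.
  by rewrite -ler_pdivrMr ?speed_gt0.
have le3 : (s / 2) ^+ 2 <= Phi beta 2^-1 ^+ 2 * (2 * (s * beta s)).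
  apply: (@le_trans _ _ ((Phi beta 2^-1 * speed beta c) ^+ 2)).
    by rewrite lerXn2r ?nnegrE ?mulr_ge0 ?Phi_ge0 ?sqrtr_ge0// ltW.
  have G0 := primitive_gt0 beta c ab c0.
  rewrite exprMn ler_wpM2l ?sqr_ge0// /speed sqr_sqrtr ?mulr_ge0 ?(ltW G0)//.
  rewrite ler_wpM2l// (le_trans (ltW (primitive_incr beta c s ab c0 cs)))//.
  by apply: primitive_le => //; exact: ltW.
rewrite -(ler_pM2r s0); move: le3; rewrite exprMn; lra.
Qed.

Lemma speed_le_beta {R : realType} (beta : R -> R) : absorption beta ->
  exists2 C, 0 < C & forall s, 1 <= s -> speed beta s <= C * beta s.
Proof.
move=> ab; have [C C0 Cle] := linear_le_beta beta ab.
exists (1 + 2 * C); first by lra.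
move=> s s1; have s0 : 0 < s by rewrite (lt_le_trans ltr01).
have b0 := beta_gt0 beta s ab s0.
have C'0 : 0 <= (1 + 2 * C) * beta s by rewrite mulr_ge0 ?(ltW b0)//; lra.
rewrite -[leRHS]ger0_norm// -sqrtr_sqr ler_wsqrtr//.
apply: (@le_trans _ _ (2 * (C * beta s * beta s))).
  rewrite ler_wpM2l// (le_trans (primitive_le beta s ab (ltW s0)))//.
  by rewrite ler_wpM2r ?Cle// ltW.
rewrite -mulrA -expr2 mulrA exprMn ler_wpM2r ?sqr_ge0//.
have := sqr_ge0 C; have -> : (1 + 2 * C) ^+ 2 = 1 + 4 * C + 4 * C ^+ 2 by ring.
lra.
Qed.

Lemma beta_unbounded {R : realType} (beta : R -> R) (M : R) : absorption beta ->
  exists2 K, 1 <= K & M <= beta K.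
Proof.
move=> ab; have [C C0 Cle] := linear_le_beta beta ab.
exists (Num.max 1 (C * M)); first by rewrite le_max lexx.
rewrite -(ler_pM2l C0); apply: le_trans (Cle _ _); last by rewrite le_max lexx.
by rewrite le_max lexx orbT.
Qed.

Lemma beta_inv_ge0 {R : realType} (beta : R -> R) (y : R) : absorption beta ->
  0 <= y -> 0 <= beta_inv beta y.
Proof.
move=> ab y0; have [K K1 yK] := beta_unbounded beta y ab.
have K0 : 0 <= K by rewrite (le_trans ler01).
have [cb incr b0 _] := ab.
have /IVT[] // : Num.min (beta 0) (beta K) <= y <= Num.max (beta 0) (beta K).
- by rewrite ge_min le_max b0 y0 yK orbT.
- by apply: continuous_subspaceW cb; apply: subset_itvl; rewrite bnd_simp.
move=> s; rewrite in_itv/= => /andP[s0 _] <-.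
rewrite /beta_inv pinvKV ?inE/= ?in_itv/= ?s0//.
move=> a b; rewrite !inE/= !in_itv/= !andbT => a0 c0.
have [lt_ab|lt_ba|//] := ltgtP a b.
- by have := incr _ _ a0 lt_ab => /[swap] ->; rewrite ltxx.
- by have := incr _ _ c0 lt_ba => /[swap] ->; rewrite ltxx.
Qed.

Lemma Phi_inv_blowup {R : realType} (beta : R -> R) (U : R) : absorption beta ->
  exists2 d, 0 < d & forall tau, 0 < tau -> tau <= Phi beta 1 -> tau < d ->
    U < Phi_inv beta tau.
Proof.
move=> ab; set m := Num.max 1 U.
have m0 : 0 < m by rewrite lt_max ltr01.
exists (Phi beta m); first exact: Phi_gt0.
move=> tau tau0 tau1 taud.
have [phi1 Pphi] := Phi_inv_spec beta tau ab tau0 tau1.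
suff : m < Phi_inv beta tau by apply: le_lt_trans; rewrite le_max lexx orbT.
rewrite ltNge; apply/negP; rewrite le_eqVlt => /predU1P[E|lt_m].
  by move: taud; rewrite -E Pphi ltxx.
have := Phi_decr beta _ _ ab (lt_le_trans ltr01 phi1) lt_m.
by rewrite Pphi => /(lt_trans taud); rewrite ltxx.
Qed.

(** * The barrier *)

(** One-variable profile of the barrier, with its first two derivatives; the
    smallness of c keeps the argument of Phi_inv in the range where the values
    are at least 1. *)
Lemma is_derive_profile {R : realType} (beta : R -> R) (c r s : R) :
  absorption beta -> 0 < c -> c * r ^+ 2 <= Phi beta 1 -> `|s| < r ->
  let phi := fun s => Phi_inv beta (c * (r ^+ 2 - s ^+ 2)) in
  [/\ 1 <= phi s,
      is_derive s 1 phi (2 * c * s * speed beta (phi s)) &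
      is_derive s 1 (fun s => 2 * c * s * speed beta (phi s))
        (2 * c * speed beta (phi s) + (2 * c * s) ^+ 2 * beta (phi s))].
Proof.
move=> ab c0 cr sr phi; set tau := fun s : R => c * (r ^+ 2 - s ^+ 2).
have r0 : 0 < r by rewrite (le_lt_trans _ sr).
have sr2 : s ^+ 2 < r ^+ 2 by rewrite -real_normK ?num_real// ltrXn2r// ltW.
have tau0 : 0 < tau s by rewrite mulr_gt0// subr_gt0.
have taule : tau s <= Phi beta 1.
  by apply: le_trans cr; rewrite ler_pM2l// gerBl sqr_ge0.
have [phi1 Pphi] := Phi_inv_spec beta (tau s) ab tau0 taule.
rewrite -/(phi s) in phi1 Pphi; have phi0 := lt_le_trans ltr01 phi1.
have dtau : is_derive s 1 tau (- (2 * c * s)).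
  have := @is_deriveZ _ _ _ _ c _ _ _ (@is_deriveB _ _ _ _ _ s 1 0 _
    (is_derive_cst (r ^+ 2) s 1)
    (@is_deriveX _ _ id 2 s 1 1 (is_derive_id s 1))).
  rewrite (_ : c *: (0 - _) = - (2 * c * s)); first by [].
  by rewrite /GRing.scale /=; ring.
have dphi : is_derive s 1 phi (2 * c * s * speed beta (phi s)).
  have dinv := is_derive_Phi_inv beta _ ab phi0; rewrite Pphi in dinv.
  have := @is_derive1_comp _ (Phi_inv beta) tau s _ _ dinv dtau.
  by rewrite mulrNN mulrC.
split=> //.
have dsp : is_derive s 1 (fun s => speed beta (phi s))
    (2 * c * s * beta (phi s)).
  have dinv := is_derive_speed_Phi_inv beta _ ab phi0; rewrite Pphi in dinv.
  have := @is_derive1_comp _ (fun x => speed beta (Phi_inv beta x)) tau s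
    _ _ dinv dtau.
  by rewrite mulrNN mulrC.
have dl : is_derive s 1 (fun s => 2 * c * s) (2 * c).
  have := @is_deriveZ _ _ _ _ (2 * c) _ _ _ (is_derive_id s 1).
  by rewrite [_ *: 1]mulr1.
have := @is_deriveM _ _ _ _ _ _ _ _ dl dsp.
rewrite (_ : _ + _ = 2 * c * speed beta (phi s)
  + (2 * c * s) ^+ 2 * beta (phi s)); first by [].
by rewrite /GRing.scale /=; ring.
Qed.

Lemma profile_blowup {R : realType} (beta : R -> R) (c r U : R) :
  absorption beta -> 0 < c -> 0 < r -> c * r ^+ 2 <= Phi beta 1 ->
  exists2 rho, rho < r & forall s, rho < `|s| < r ->
    U < Phi_inv beta (c * (r ^+ 2 - s ^+ 2)).
Proof.
move=> ab c0 r0 cr; have [d d0 dU] := Phi_inv_blowup beta U ab.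
(* r ^ 2 - s ^ 2 <= 2 r (r - |s|), which makes c * (r ^ 2 - s ^ 2) < d. *)
exists (r - d / (2 * c * r)).
  by rewrite gtrDl oppr_lt0 divr_gt0// !mulr_gt0.
move=> s /andP[rhos sr]; apply: dU.
- by rewrite mulr_gt0// subr_gt0 -real_normK ?num_real// ltrXn2r// ltW.
- by apply: le_trans cr; rewrite ler_pM2l// gerBl sqr_ge0.
have p0 : 0 < r + `|s| by rewrite ltr_wpDr.
rewrite -real_normK ?num_real// subr_sqr mulrCA -ltr_pdivlMr ?mulr_gt0//.
have : r - `|s| < d / (2 * c * r) by lra.
move=> /lt_le_trans; apply; rewrite ler_pM2l// lef_pV2 ?posrE ?mulr_gt0//.
by rewrite [2 * c]mulrC -mulrA ler_pM2l//; lra.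
Qed.

(** Every t_i is at least 1 and at most w = \sum_i K t_i, so both speed (t_i)
    and beta (t_i) are controlled by beta w; c ^ 2 <= c makes the two terms of
    the second derivative of the same order in c. *)
Lemma barrier_supersolution {R : realType} {N : nat} (beta : R -> R)
    (c C D K L : R) (P s t : 'I_N -> R) :
  absorption beta -> 0 < c -> c <= 1 -> 0 < C -> 0 < D -> 1 <= K ->
  (forall y, 1 <= y -> speed beta y <= C * beta y) ->
  L * K * N%:R * (c * (2 * C + 4 * D ^+ 2)) <= 2^-1 ->
  (forall i, 0 <= P i <= L) -> (forall i, `|s i| <= D) ->
  (forall i, 1 <= t i) ->
  \sum_i P i * (K * (2 * c * speed beta (t i)
      + (2 * c * s i) ^+ 2 * beta (t i)))
    <= beta (\sum_i K * t i) / 2.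
Proof.
move=> ab c0 c1 C0 D0 K1 speedle small PL sD t1.
set w := \sum_i K * t i.
have K0 : 0 < K by rewrite (lt_le_trans ltr01).
have tw i : t i <= w.
  rewrite /w (bigD1 i)//= (@le_trans _ _ (K * t i)) ?ler_peMl//.
    by rewrite (le_trans ler01).
  rewrite lerDl; apply: sumr_ge0 => j _.
  by rewrite mulr_ge0 ?(ltW K0)// (le_trans ler01).
have bound i : P i * (K * (2 * c * speed beta (t i)
      + (2 * c * s i) ^+ 2 * beta (t i)))
    <= L * (K * (c * (2 * C + 4 * D ^+ 2) * beta w)).
  have ti0 : 0 < t i by rewrite (lt_le_trans ltr01).
  have b0 := beta_gt0 beta (t i) ab ti0.
  have bw : beta (t i) <= beta w by rewrite beta_le// ltW.
  have /andP[P0 PLi] := PL i.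
  have sp0 := speed_gt0 beta (t i) ab ti0.
  have s2 : s i ^+ 2 <= D ^+ 2.
    by rewrite -real_normK ?num_real// lerXn2r ?nnegrE// ltW.
  apply: ler_pM => //.
    apply: mulr_ge0; first exact: ltW.
    apply: addr_ge0; first by apply: mulr_ge0; [lra|exact: ltW].
    by rewrite mulr_ge0 ?sqr_ge0// ltW.
  rewrite ler_pM2l// (@le_trans _ _ (c * (2 * C + 4 * D ^+ 2) * beta (t i)))//.
    have := speedle _ (t1 i).
    rewrite -(ler_pM2l (mulr_gt0 (ltr0Sn _ 1) c0)) => h1.
    have h2 : (2 * c * s i) ^+ 2 <= 4 * c * D ^+ 2.
      rewrite (_ : (2 * c * s i) ^+ 2 = 4 * (c ^+ 2 * s i ^+ 2)); last by ring.
      rewrite -mulrA ler_pM2l// ler_pM ?sqr_ge0//.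
      by rewrite expr2 ler_piMr// ltW.
    have := ler_wpM2r (ltW b0) h2; lra.
  have := sqr_ge0 D => D20.
  by rewrite ler_wpM2l// mulr_ge0 ?(ltW c0)//; lra.
apply: le_trans (ler_sum _ (fun i _ => bound i)) _.
rewrite sumr_const card_ord -mulr_natr.
have bw0 : 0 <= beta w.
  have [_ _ <- _] := ab; apply: beta_le => //; apply: sumr_ge0 => j _.
  by rewrite mulr_ge0 ?(ltW K0)// (le_trans ler01).
have := ler_wpM2r bw0 small; lra.
Qed.

(** * Comparison with the solution *)

(** The equation reads beta u = min f n + tr (P D2u), with P = calA + eps I
    semidefinite.  Its diagonal entries are values of the quadratic form at unit
    vectors, which is where the bound Lambda enters. *)
Lemma hessian_touching_trace_le {R : realType} {N : nat} (Omega : set 'rV[R]_N)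
    (calA : 'rV[R]_N -> 'M[R]_N) (beta : R -> R) (f : 'rV[R]_N -> R)
    (eps Lambda : R) (n : nat) (u : 'rV[R]_N -> R) (z : 'rV[R]_N)
    (d : 'I_N -> R) :
  (forall x, Omega x -> psd_mx (calA x) /\ calA x <> 0) ->
  (forall x xi, Omega x -> enorm xi = 1 ->
       0 <= \tr (calA x *m tensor xi) <= Lambda) ->
  0 < eps -> classical_solution Omega calA beta f eps n u -> Omega z ->
  (forall v : 'rV_N,
    (v *m hessian u z *m v^T) 0 0 <= \sum_i d i * v 0 i ^+ 2) ->
  exists2 P : 'I_N -> R, (forall i, 0 <= P i <= Lambda + eps) &
    beta (u z) <= f z + \sum_i P i * d i.
Proof.
move=> Apsd Abounds eps0 [_ _ pde _] Oz hess.
have [[symA _] _] := Apsd z Oz.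
have formA xi : enorm xi = 1 -> 0 <= (xi *m calA z *m xi^T) 0 0 <= Lambda.
  by rewrite -tr_mul_tensor; exact: Abounds.
pose P := calA z + eps%:M.
have symP : P^T = P by rewrite linearD /= symA tr_scalar_mx.
have psdP (v : 'rV_N) : 0 <= (v *m P *m v^T) 0 0.
  rewrite mulmxDr mulmxDl mxE addr_ge0//.
    by apply: form_ge0_of_unit => xi /formA /andP[].
  rewrite mul_mx_scalar -scalemxAl mxE mulr_ge0 ?(ltW eps0)// mxE.
  by apply: sumr_ge0 => i _; rewrite mxE -expr2 sqr_ge0.
exists (fun i => P i i).
  move=> i; have := formA _ (enorm_delta i); rewrite form_delta => /andP[A0 AL].
  by rewrite !mxE eqxx mulr1n lerD2r AL addr_ge0// ltW.
have := tr_mul_psd_le_diag P _ d symP psdP hess.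
have -> : \tr (P *m hessian u z)
    = \tr (calA z *m hessian u z) + eps * laplacian u z.
  rewrite mulmxDl linearD /= mul_scalar_mx linearZ /=; congr (_ + _ * _).
  by apply: eq_bigr => i _; rewrite mxE.
have := pde z Oz; have : Num.min (f z) n%:R <= f z by rewrite ge_min lexx.
by move=> h1 h2 h3; lra.
Qed.

Theorem theorem4p2 (R : realType) (N : nat) (hN : (1 < N)%N)
    (Omega : set 'rV[R]_N)
    (Omega_open : open Omega) (Omega_bounded : bounded_set Omega)
    (calA : 'rV[R]_N -> 'M[R]_N)
    (calA_psd : forall x, Omega x -> psd_mx (calA x) /\ calA x <> 0)
    (calA_lipschitz : [lipschitz calA x | x in Omega])
    (beta : R -> R)
    (beta_ge0 : forall s, 0 <= s -> 0 <= beta s)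
    (beta_continuous : {within [set` `[0, +oo[], continuous beta})
    (beta_increasing : forall s t, 0 <= s -> s < t -> beta s < beta t)
    (beta0 : beta 0 = 0)
    (f : 'rV[R]_N -> R)
    (f_ge0 : forall x, Omega x -> 0 <= f x)
    (f_uniformly_continuous : uniformly_continuous_on Omega f)
    (Lambda : R) (Lambda_gt0 : 0 < Lambda)
    (calA_bounds : forall x xi, Omega x -> enorm xi = 1 ->
       0 <= \tr (calA x *m tensor xi) <= Lambda)
    (beta_KO : Keller_Osserman beta)
    (omega : R -> R)
    (omega_ge0 : forall s, 0 <= s -> 0 <= omega s)
    (omega0 : omega s @[s --> 0^'+] --> (0 : R))
    (calA_structure : forall (x y : 'rV[R]_N) (alpha : R) (X Y : 'M[R]_N),
       Omega x -> Omega y -> 0 < alpha ->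
       symmetric_mx X -> symmetric_mx Y ->
       mx_le (- (3 * alpha) *: block_mx 1%:M 0 0 1%:M)
             (block_mx X 0 0 (- Y)) ->
       mx_le (block_mx X 0 0 (- Y))
             ((3 * alpha) *: block_mx 1%:M (- 1%:M) (- 1%:M) 1%:M) ->
       \tr (calA x *m X) - \tr (calA y *m Y)
         <= omega (alpha * enorm (x - y) ^+ 2))
    (eps : R) (eps_gt0 : 0 < eps) :
  exists A B : R, [/\ 0 < A, 0 < B &
    forall (n : nat) (u : 'rV[R]_N -> R),
      classical_solution Omega calA beta f eps n u ->
      forall (x0 : 'rV[R]_N) (r : R),
        0 < r -> compactly_contained (cube x0 r) Omega ->
        ((B * r ^+ 2 / Num.sqrt (Lambda + eps))%:E < Phi0 beta)%E /\
        forall x, cube x0 r x ->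
          u x <= \sum_(i < N)
                   Psi beta Lambda eps A B
                     (r ^+ 2 - `|x 0 i - x0 0 i| ^+ 2)
                 + beta_inv beta (sup_norm (cube x0 r) f)].
Proof.
have ab : absorption beta by split.
have N0 : (0 < N)%N by exact: ltnW.
have [F fF] := uniformly_continuous_bounded Omega f Omega_bounded
  f_uniformly_continuous.
have [D D0 rD] := cube_radius_bounded Omega N0 Omega_bounded.
have [C C0 speedle] := speed_le_beta beta ab.
have [K K1 FK] := beta_unbounded beta (2 * F) ab.
have K0 : 0 < K := lt_le_trans ltr01 K1.
set L := Lambda + eps; have L0 : 0 < L by rewrite addr_gt0.
have sqL0 : 0 < Num.sqrt L by rewrite sqrtr_gt0.
have P10 := Phi_gt0 beta 1 ab ltr01.
have D20 : 0 < D ^+ 2 by rewrite exprn_gt0.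
(* \sum_i P_ii d_i <= E * c * beta w. *)
pose E := L * K * N%:R * (2 * C + 4 * D ^+ 2).
have E0 : 0 < E by rewrite !mulr_gt0 ?ltr0n//; lra.
(* The three bounds on c serve c ^ 2 <= c, the range of Phi_inv, and the
   supersolution inequality. *)
pose c := Num.min 1 (Num.min (Phi beta 1 / D ^+ 2) (2^-1 / E)).
have c0 : 0 < c by rewrite !lt_min ltr01 !divr_gt0.
have c1 : c <= 1 by rewrite ge_min lexx.
have cD : c * D ^+ 2 <= Phi beta 1.
  by rewrite -ler_pdivlMr// /c !ge_min lexx orbT.
have cE : L * K * N%:R * (c * (2 * C + 4 * D ^+ 2)) <= 2^-1.
  rewrite mulrCA -/E -ler_pdivlMr//; by rewrite /c !ge_min lexx !orbT.
exists K^-1, (c * Num.sqrt L).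
split; [by rewrite invr_gt0|by rewrite mulr_gt0|].
move=> n u sol x0 r r0 QcO; have [_ QO] := QcO.
have QsubO : cube x0 r `<=` Omega by move=> y Qy; exact/QO/subset_closure.
have rleD := rD x0 r r0 QsubO.
have cr : c * r ^+ 2 <= Phi beta 1.
  by apply: le_trans cD; rewrite ler_pM2l// lerXn2r ?nnegrE ?(ltW r0) ?(ltW D0).
split.
  apply: le_lt_trans (Phi1_lt_Phi0 beta ab); rewrite lee_fin.
  by rewrite -/L mulrAC mulfK ?gt_eqF.
pose phi s := Phi_inv beta (c * (r ^+ 2 - s ^+ 2)).
pose q s := K * phi s.
move=> x Qx.
have PsiE s :
    Psi beta Lambda eps K^-1 (c * Num.sqrt L) (r ^+ 2 - `|s| ^+ 2) = q s.
  by rewrite /Psi invrK -/L mulfK ?gt_eqF// real_normK ?num_real.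
under eq_bigr do rewrite PsiE.
have f_sup : 0 <= sup_norm (cube x0 r) f.
  have supf : has_sup [set `|f y| | y in cube x0 r].
    split; first by exists `|f x|, x.
    by exists F => _ [y Qy <-]; rewrite ger0_norm ?f_ge0 ?fF//; exact: QsubO.
  apply: le_trans (normr_ge0 (f x)) _.
  by apply: sup_upper_bound => //; exists x.
have M0 := beta_inv_ge0 beta _ ab f_sup.
suff : u x <= \sum_(i < N) q (x 0 i - x0 0 i).
  by move=> /le_trans; apply; rewrite lerDl.
rewrite leNgt; apply/negP => wux.
have profile s := is_derive_profile beta c r s ab c0 cr.
have Qsr y i : cube x0 r y -> `|y 0 i - x0 0 i| < r by apply.
pose q2 s := K * (2 * c * speed beta (phi s) + (2 * c * s) ^+ 2 * beta (phi s)).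
have uC2 : C2_on Omega u by case: sol.
have [||||z [Qz wuz hess]] := @exists_touching_point _ _ Omega u x0 x r q
    (fun s => K * (2 * c * s * speed beta (phi s))) q2
    Omega_open uC2 QcO _ _ _ _ Qx wux.
- move=> s /profile [phi1 _ _]; rewrite mulr_ge0 ?(ltW K0)//.
  exact: le_trans ler01 phi1.
- by move=> s /profile [_ dphi _]; exact: (@is_deriveZ _ _ _ _ K _ _ _ dphi).
- by move=> s /profile [_ _ dphi]; exact: (@is_deriveZ _ _ _ _ K _ _ _ dphi).
- move=> U; have [rho rhor rhoU] := profile_blowup beta c r U ab c0 r0 cr.
  exists rho => // s /[dup] /rhoU Uphi /andP[_ /profile [phi1 _ _]].
  apply: lt_le_trans Uphi _; rewrite ler_peMl//.
  exact: le_trans ler01 phi1.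
have Oz := QsubO z Qz.
have phi1 i : 1 <= phi (z 0 i - x0 0 i) by have [] := profile _ (Qz i).
have [P PL betau] := @hessian_touching_trace_le _ _ _ _ _ _ _ _ _ _ _
  (fun i => q2 (z 0 i - x0 0 i)) calA_psd calA_bounds eps_gt0 sol Oz hess.
have super := @barrier_supersolution _ _ beta c C D K L P
  (fun i => z 0 i - x0 0 i) (fun i => phi (z 0 i - x0 0 i))
  ab c0 c1 C0 D0 K1 speedle cE PL (fun i => le_trans (ltW (Qz i)) rleD) phi1.
set w := \sum_i K * phi _ in super.
have Kw : K <= w.
  rewrite /w (bigD1 (Ordinal N0))//= -[leLHS]addr0 lerD//.
    by rewrite ler_peMr ?(ltW K0).
  apply: sumr_ge0 => j _; rewrite mulr_ge0 ?(ltW K0)//.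
  exact: le_trans ler01 (phi1 j).
have bKw : beta K <= beta w by rewrite beta_le// ltW.
have fzF := fF z Oz.
have : beta w < beta (u z).
  by apply: beta_increasing wuz; rewrite (le_trans _ Kw)// ltW.
rewrite ltNge; have -> // : beta (u z) <= beta w; lra.
Qed.
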